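(* Let $\delta\ge 0$ and let $a(n)=an^\delta+\cdots$, $b(n)=bn^\delta+\cdots$, $c(n)=cn^\delta+\cdots$ be real polynomials in $n$ of degree $\delta$ with positive leading coefficients $a,b,c$, taking positive values for all integers $n\ge1$. If $b^2>4ac$, then every nontrivial (not identically zero) real sequence $(u_n)_{n\ge0}$ satisfying $$a(n)u_{n+1}=b(n)u_n-c(n)u_{n-1},\qquad n=1,2,\ldots$$ is eventually sign-definite, i.e. there is $N$ such that either $u_n>0$ for all $n\ge N$ or $u_n<0$ for all $n\ge N$. *)

(* Defs.v *)
From mathcomp Require Export all_boot all_order all_algebra.
From mathcomp Require Export reals.

Set Implicit Arguments.
Unset Strict Implicit.
Unset Printing Implicit Defensive.

(* Main.v *)
Require Import Defs.
From mathcomp Require Import all_boot all_order all_algebra.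
From mathcomp Require Import reals.
From mathcomp Require Import boolp polyrcf lra.
Import Order.TTheory GRing.Theory Num.Theory.
Local Open Scope ring_scope.

(** With [t = b / (2a)] the characteristic value [b t - a t^2 - c] is positive,
    hence [b(n) t - a(n) t^2 - c(n) > 0] for large [n].  From then on, the
    condition [u_n > 0 /\ t u_(n-1) <= u_n] propagates to all later indices, and
    so does its mirror image for [-u].  If neither condition is ever met, then
    [u_n] and [u_(n-1)] have the same nonzero sign for all large [n]. *)

(** Beyond some real [m] the values of [p] are at least its leading coefficient; the Archimedean
    property replaces [m] by a natural number. *)
Lemma eventually_horner_gt0 (R : realType) (p : {poly R}) :
  0 < lead_coef p ->
  exists N : nat, forall n : nat, (N <= n)%N -> 0 < p.[n%:R].
Proof.
move=> lp; have [m Hm] := poly_pinfty_gt_lc lp.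
exists (Num.bound `|m|) => n Hn.
apply: lt_le_trans lp (Hm _ _).
apply: le_trans (ler_norm _) _; apply: ltW.
apply: lt_le_trans (archi_boundP (normr_ge0 m)) _.
by rewrite ler_nat.
Qed.

Section PositiveRecurrence.
Variables (R : realFieldType) (A B C : nat -> R) (t : R) (N : nat).
Hypotheses (t_gt0 : 0 < t)
  (A_gt0 : forall n, (1 <= n)%N -> 0 < A n)
  (C_gt0 : forall n, (1 <= n)%N -> 0 < C n)
  (char_gt0 : forall n, (N <= n)%N -> 0 < B n * t - A n * t ^+ 2 - C n).

Definition solution (u : nat -> R) :=
  forall n, A n.+1 * u n.+2 = B n.+1 * u n.+1 - C n.+1 * u n.

Lemma solutionN u : solution u -> solution (fun n => - u n).
Proof. by move=> u_rec n; rewrite !mulrN u_rec opprB opprK addrC. Qed.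

(** With [A], [B], [C] taken at [n.+1], the recurrence gives [A t (u n.+2 - t u n.+1) = (B t - A t^2
    - C) u n.+1 + C (u n.+1 - t u n)], and both summands are nonnegative. *)
Lemma solution_growth u n : solution u -> (N <= n.+1)%N ->
  0 < u n.+1 -> t * u n <= u n.+1 ->
  0 < u n.+2 /\ t * u n.+1 <= u n.+2.
Proof.
move=> u_rec Nn u1 u01.
have A1 := A_gt0 n.+1 isT; have C1 := C_gt0 n.+1 isT.
have key : A n.+1 * t * (t * u n.+1) <= A n.+1 * t * u n.+2.
  have -> : A n.+1 * t * u n.+2 = t * (A n.+1 * u n.+2) by rewrite mulrAC mulrC.
  rewrite u_rec.
  have h1 : 0 <= C n.+1 * (u n.+1 - t * u n).
    by rewrite mulr_ge0 ?subr_ge0 // ltW.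
  have h2 := mulr_gt0 (char_gt0 _ Nn) u1.
  nra.
rewrite ler_pM2l ?mulr_gt0 // in key; split => //.
by apply: lt_le_trans key; rewrite mulr_gt0.
Qed.

Lemma solution_eventually_gt0 u n : solution u -> (N <= n.+1)%N ->
  0 < u n.+1 -> t * u n <= u n.+1 ->
  forall m, (n.+1 <= m)%N -> 0 < u m.
Proof.
move=> u_rec Nn u1 u01 m /subnK <-; set k := (m - _)%N.
suff [] : 0 < u (k + n).+1 /\ t * u (k + n)%N <= u (k + n).+1.
  by rewrite addnS.
elim: k => [|k [IH1 IH2]]; first by [].
apply: solution_growth => //.
by apply: leq_trans Nn _; rewrite ltnS leq_addl.
Qed.

(** Two consecutive zeros spread backwards to [u 0 = u 1 = 0] because [C] does not vanish, and from
    there forwards to every index because [A] does not vanish. *)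
Lemma solution_not_zero_pair u n : solution u -> (exists m, u m != 0) ->
  u n = 0 -> u n.+1 != 0.
Proof.
move=> u_rec [m um] un; apply/eqP => un1; move/eqP: um; apply.
have u01 : u 0 = 0 /\ u 1 = 0.
  elim: n un un1 => [|n IH] // un un1; apply: IH => //.
  have := u_rec n; rewrite un un1 !mulr0 sub0r => /esym/eqP.
  by rewrite oppr_eq0 mulf_eq0 gt_eqF ?C_gt0 //= => /eqP.
suff [] : u m = 0 /\ u m.+1 = 0 by [].
elim: m => [|m [IH1 IH2]] //; split=> //.
have := u_rec m; rewrite IH1 IH2 !mulr0 subr0 => /eqP.
by rewrite mulf_eq0 gt_eqF ?A_gt0 //= => /eqP.
Qed.

Lemma solution_sign_definite u : solution u -> (exists m, u m != 0) ->
  exists M, (forall n, (M <= n)%N -> 0 < u n) \/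
            (forall n, (M <= n)%N -> u n < 0).
Proof.
move=> u_rec u_nz.
have [[n [Nn u1 u01]]|noP] :=
  pselect (exists n, [/\ (N <= n)%N, 0 < u n.+1 & t * u n <= u n.+1]).
  exists n.+1; left.
  exact: (solution_eventually_gt0 _ _ u_rec (leqW Nn) u1 u01).
have [[n [Nn u1 u01]]|noN] :=
  pselect (exists n, [/\ (N <= n)%N, u n.+1 < 0 & u n.+1 <= t * u n]).
  exists n.+1; right => m nm; rewrite -oppr_gt0.
  apply: (solution_eventually_gt0 _ _ (solutionN _ u_rec) (leqW Nn)) nm.
    by rewrite oppr_gt0.
  by rewrite mulrN lerN2.
(* If [u n <= 0 < u n.+1], then [t * u n <= 0 < u n.+1], which is the growth condition excluded by
   [noP]. *)
have pos_pred n : (N <= n)%N -> 0 < u n.+1 -> 0 < u n.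
  move=> Nn u1; rewrite -(pmulr_rgt0 _ t_gt0) ltNge; apply/negP => u0.
  by apply: noP; exists n; split=> //; apply: le_trans u0 (ltW u1).
have neg_pred n : (N <= n)%N -> u n.+1 < 0 -> u n < 0.
  move=> Nn u1; rewrite -(pmulr_rlt0 _ t_gt0) ltNge; apply/negP => u0.
  by apply: noN; exists n; split=> //; apply: le_trans (ltW u1) u0.
(* After a zero the next term is nonzero, and its sign would pass back to the zero itself. *)
have nz n : (N <= n)%N -> u n != 0.
  move=> Nn; apply/eqP => un.
  have := solution_not_zero_pair _ _ u_rec u_nz un.
  by rewrite neq_lt => /orP[/(neg_pred _ Nn)|/(pos_pred _ Nn)]; rewrite un ltxx.
(* The sign at [N] persists: a term of the opposite sign would force that sign on its
   predecessor. *)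
exists N; have /orP[uN|uN] : (u N < 0) || (0 < u N) by rewrite -neq_lt nz.
- right=> n /subnK <-; elim: (n - N)%N => [|k IH] //.
  have Nk : (N <= k + N)%N by rewrite leq_addl.
  have /orP[//|/(pos_pred _ Nk)] : (u (k + N).+1 < 0) || (0 < u (k + N).+1).
    by rewrite -neq_lt nz // leqW.
  by rewrite ltNge ltW.
- left=> n /subnK <-; elim: (n - N)%N => [|k IH] //.
  have Nk : (N <= k + N)%N by rewrite leq_addl.
  have /orP[/(neg_pred _ Nk)|//] : (u (k + N).+1 < 0) || (0 < u (k + N).+1).
    by rewrite -neq_lt nz // leqW.
  by rewrite ltNge ltW.
Qed.

End PositiveRecurrence.

Theorem theorem1p3 (R : realType) (delta : nat) (a b c : {poly R})
  (size_a : size a = delta.+1) (size_b : size b = delta.+1)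
  (size_c : size c = delta.+1)
  (lead_a : 0 < lead_coef a) (lead_b : 0 < lead_coef b)
  (lead_c : 0 < lead_coef c)
  (a_pos : forall n : nat, (1 <= n)%N -> 0 < a.[n%:R])
  (b_pos : forall n : nat, (1 <= n)%N -> 0 < b.[n%:R])
  (c_pos : forall n : nat, (1 <= n)%N -> 0 < c.[n%:R])
  (disc : lead_coef b ^+ 2 > 4 * lead_coef a * lead_coef c)
  (u : nat -> R) (u_nontrivial : exists n : nat, u n != 0)
  (u_rec : forall n : nat, (1 <= n)%N ->
    a.[n%:R] * u n.+1 = b.[n%:R] * u n - c.[n%:R] * u n.-1) :
  exists N : nat,
    (forall n : nat, (N <= n)%N -> 0 < u n) \/
    (forall n : nat, (N <= n)%N -> u n < 0).
Proof.
(* This is the maximizer of [b t - a t^2 - c] for the leading coefficients; the maximum is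
   [(b^2 - 4 a c) / (4 a)]. *)
pose t := lead_coef b / (2 * lead_coef a).
have t_gt0 : 0 < t by rewrite divr_gt0 ?mulr_gt0.
pose p := t *: b - t ^+ 2 *: a - c.
have p_delta : 0 < p`_delta.
  have la : a`_delta = lead_coef a by rewrite lead_coefE size_a.
  have lb : b`_delta = lead_coef b by rewrite lead_coefE size_b.
  have lc : c`_delta = lead_coef c by rewrite lead_coefE size_c.
  rewrite !coefE la lb lc.
  have tE : 2 * lead_coef a * t = lead_coef b.
    by rewrite mulrC divfK // gt_eqF ?mulr_gt0.
  (* After multiplication by the leading coefficient [a], substituting [b = 2 a t] turns both the
     goal and [disc] into [a^2 t^2 > a c], up to positive factors. *)
  rewrite -(pmulr_rgt0 _ lead_a).
  move: disc; rewrite -tE; nra.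
(* No cancellation occurs in degree [delta], so the positive coefficient [p_delta] is the leading
   one. *)
have size_p : size p = delta.+1.
  apply/eqP; rewrite eqn_leq; apply/andP; split; last first.
    rewrite ltnNge; apply/negP => /leq_sizeP/(_ _ (leqnn _)) p0.
    by rewrite p0 ltxx in p_delta.
  apply/leq_sizeP => j dj.
  by rewrite !coefE !nth_default ?size_a ?size_b ?size_c // !mulr0 !subr0.
have [|N pN] := @eventually_horner_gt0 _ p; first by rewrite lead_coefE size_p.
apply: (@solution_sign_definite _ (fun n => a.[n%:R]) (fun n => b.[n%:R])
          (fun n => c.[n%:R]) t N) => //.
- move=> n /pN pn; rewrite (mulrC _ t) (mulrC _ (t ^+ 2)).
  by move: pn; rewrite !(hornerD, hornerN, hornerZ).
- by move=> n; apply: u_rec.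
Qed.
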